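(* Let $\mathcal{A}_q$ and $\mathcal{A}_q'$ be quantum cluster algebras of rank $n$ with quantum seeds $\Sigma=(\mathbf{x},\widetilde B,\Lambda)$, $\mathbf{x}=(x_1,\dots,x_m)$, and $\Sigma'=(\mathbf{x}',\widetilde B',\Lambda')$, $\mathbf{x}'=(x_1',\dots,x_{m'}')$, respectively, having the same exchange matrix $B=B'$. A map $f$ defined on $\mathbf{x}$ with values in the quantum torus $\mathbb{T}(\Sigma')$ induces a (quantum) quasi-homomorphism from $\mathcal{A}_q$ to $\mathcal{A}_q'$ (with respect to $\Sigma$ and $\Sigma'$) if and only if the following conditions are satisfied: 1. $f(x_i)=X'^{e_i'+\tilde h_i}$ for $1\le i\le n$, where $\tilde h_i=\binom{0}{h_i}$ with $h_i\in\mathbb{Z}^{m'-n}$; 2. $f(x_{n+j})=X'^{\tilde l_j}$ for $1\le j\le m-n$, where $\tilde l_j=\binom{0}{l_j}$ with $l_j\in\mathbb{Z}^{m'-n}$; 3. $R\widetilde B=\widetilde B'$, where $L=(l_1,\dots,l_{m-n})$, $H=(h_1,\dots,h_n)$ and $R=\begin{pmatrix} I_{n\times n}&0\\ H&L\end{pmatrix}\in\mathrm{Mat}_{m'\times m}(\mathbb{Z})$; 4. $R^t\Lambda'R=\Lambda$.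
   Context: $\mathbb{C}_q=\mathbb{C}(q^{\pm1/2})$, $q$ an indeterminate; $[b]_+=\max(b,0)$, applied entrywise. A **quantum seed** of rank $n$ is $\Sigma=(\mathbf{x},\widetilde B,\Lambda)$: $\mathbf{x}=(x_1,\dots,x_m)$; $\widetilde B=\binom{B}{C}\in\mathrm{Mat}_{m\times n}(\mathbb{Z})$ whose top $n\times n$ part $B$ (the exchange matrix) satisfies that $DB$ is skew-symmetric for some diagonal matrix $D$ with positive integer diagonal entries; $\Lambda=(\lambda_{ij})\in\mathrm{Mat}_{m\times m}(\mathbb{Z})$ skew-symmetric with $\widetilde B^t\Lambda=(D,0_{n\times(m-n)})$. Standing assumptions: $\widetilde B$ and $B$ are indecomposable, $n>1$. $x_1,\dots,x_n$ are cluster variables and $x_{n+1},\dots,x_m$ are frozen (coefficient) variables. The **quantum torus** $\mathbb{T}(\Sigma)$ has $\mathbb{C}_q$-basis $X^a$, $a\in\mathbb{Z}^m$, with $X^aX^b=q^{\frac12\Lambda(a,b)}X^{a+b}$, $\Lambda(a,b)=a^t\Lambda b$, and $X^{e_i}=x_i$ for the standard basis $e_i$. $\mathbb{P}$ is the set of $X^{(0,a)}$, $0\in\mathbb{Z}^n$, $a\in\mathbb{Z}^{m-n}$. For $\Sigma'$ the corresponding objects are denoted with primes ($X'^a$, $e_i'$, $b_i'$, ...). **Mutation** $\mu_k$ ($1\le k\le n$): $x_k$ is replaced by $\mu_k(x_k)=X^{-e_k+[b_k]_+}+X^{-e_k+[-b_k]_+}$ ($b_k$ the $k$-th column of $\widetilde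 B$); $\mu_k(\widetilde B)=(b'_{ji})$ with $b'_{ji}=-b_{ji}$ if $i=k$ or $j=k$, and $b'_{ji}=b_{ji}+[-b_{jk}]_+b_{ki}+b_{jk}[b_{ki}]_+$ otherwise; $\mu_k(\Lambda)$ is the skew-symmetric matrix with $\lambda'_{ji}=\lambda_{ji}$ for $i,j\ne k$ and $\lambda'_{jk}=\Lambda(e_j,-e_k+[b_k]_+)$ for $j\neq k$. The **quantum cluster algebra** $\mathcal{A}_q(\Sigma)$ is generated over $\mathbb{C}_q\mathbb{P}$ by all cluster variables of all seeds obtained from $\Sigma$ by iterated mutation; it is contained in $\mathbb{T}(\Sigma)$. A $\mathbb{C}_q$-algebra homomorphism $f:\mathcal{A}_q\to\mathcal{A}_q'$ is a **(quantum) quasi-homomorphism** (with respect to $\Sigma,\Sigma'$) if (1) $B=B'$; (2) $f(x_i)=X'^{e_i'+\tilde h_i}$ for $1\le i\le n$ and $f(x_j)=X'^{\tilde l_j}$ for $n+1\le j\le m$, where $\tilde h_i,\tilde l_j\in\mathbb{Z}^{m'}$ have first $n$ coordinates $0$, and $f(\hat y_i)=\hat y_i'$ for $1\le i\le n$, where $\hat y_i=X^{b_i}$, $\hat y_i'=X'^{b_i'}$ with $b_i,b_i'$ the $i$-th columns of $\widetilde B,\widetilde B'$ ($f$ being extended to $\mathbb{T}(\Sigma)\to\mathbb{T}(\Sigma')$). A map $f$ on $\mathbf{x}$ ''induces'' a quasi-homomorphism if it extends to a $\mathbb{C}_q$-algebra homomorphism $\mathcal{A}_q\to\mathcal{A}_q'$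 that is a quasi-homomorphism. *)

(* Defs.v *)
From HB Require Import structures.
From mathcomp Require Import all_boot all_order all_algebra.
From mathcomp Require Import complex boolp reals finmap monalg.

Set Implicit Arguments.
Unset Strict Implicit.
Unset Printing Implicit Defensive.

Import Order.TTheory GRing.Theory Num.Theory.
Local Open Scope ring_scope.

(* A field with a distinguished element [qh] standing for q^{1/2}, so that    *)
(* q^{k/2} is [qh ^ k]. The instance of interest is [Cq R] below.             *)
Record qfield := QField {
  qfield_sort :> fieldType;
  qh : qfield_sort;
  qh_neq0 : qh != 0
}.

Lemma tofracX_neq0 (R : realType) : @tofrac {poly R[i]} 'X != 0.
Proof. by rewrite tofrac_eq0 polyX_eq0. Qed.

(* C(q^{1/2}) for C = R[i], the indeterminate of the polynomials over C being *)
(* q^{1/2}.                                                                   *)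
Definition Cq (R : realType) : qfield := QField (tofracX_neq0 R).

(* The product on the free K-module over V such that                          *)
(* << a >> * << b >> = w a b *: << a + b >>.                                  *)
Section TwistedProduct.
Context (K : fieldType) (V : zmodType) (w : V -> V -> K).
Implicit Types (g : {malg K[V]}) (a b : V) (c : K).
Local Open Scope fset_scope. Local Open Scope ring_scope.

Definition twmul g1 g2 : {malg K[V]} :=
  \sum_(a <- msupp g1) \sum_(b <- msupp g2)
    << g1@_a * g2@_b * w a b *g a + b >>.

Lemma twmulw (d1 d2 : {fset V}) g1 g2 :
  msupp g1 `<=` d1 -> msupp g2 `<=` d2 ->
  twmul g1 g2 = \sum_(a <- d1) \sum_(b <- d2)
    << g1@_a * g2@_b * w a b *g a + b >>.
Proof.
move=> le1 le2; rewrite /twmul (big_fset_incl _ le1) /=; last first.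
  by move=> a _ /mcoeff_outdom g1a; rewrite big1 // => b _;
     rewrite g1a !mul0r monalgU0.
apply: eq_bigr => a _; apply: big_fset_incl => // b _ /mcoeff_outdom ->.
by rewrite mulr0 mul0r monalgU0.
Qed.

Lemma twmulDl : left_distributive twmul +%R.
Proof.
move=> g1 g2 g; rewrite (twmulw (msuppD_le _ _) (fsubset_refl _)).
rewrite [in RHS](twmulw (fsubsetUl _ (msupp g2)) (fsubset_refl _)).
rewrite [in RHS](twmulw (fsubsetUr (msupp g1) _) (fsubset_refl _)).
rewrite -big_split /=; apply: eq_bigr => a _.
rewrite -big_split /=; apply: eq_bigr => b _.
by rewrite mcoeffD !mulrDl monalgUD.
Qed.

Lemma twmulDr : right_distributive twmul +%R.
Proof.
move=> g g1 g2; rewrite (twmulw (fsubset_refl _) (msuppD_le _ _)).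
rewrite [in RHS](twmulw (fsubset_refl _) (fsubsetUl _ (msupp g2))).
rewrite [in RHS](twmulw (fsubset_refl _) (fsubsetUr (msupp g1) _)).
rewrite -big_split /=; apply: eq_bigr => a _.
rewrite -big_split /=; apply: eq_bigr => b _.
by rewrite mcoeffD mulrDr mulrDl monalgUD.
Qed.

Lemma twmul0g : left_zero 0 twmul.
Proof. by move=> g; rewrite /twmul msupp0 big_seq_fset0. Qed.

Lemma twmulg0 : right_zero 0 twmul.
Proof.
by move=> g; rewrite /twmul big1 // => a _; rewrite msupp0 big_seq_fset0.
Qed.

Lemma twmulUU c1 c2 a b :
  twmul << c1 *g a >> << c2 *g b >> = << c1 * c2 * w a b *g a + b >>.
Proof. by rewrite (twmulw msuppU_le msuppU_le) !big_seq_fset1 !mcoeffUU. Qed.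

Lemma malg_scaleU c a x : c *: << x *g a >> = << c * x *g a >> :> {malg K[V]}.
Proof. by apply/malgP => b; rewrite mcoeffZ !mcoeffU mulrnAr. Qed.

Lemma malg_ind (P : {malg K[V]} -> Prop) :
  P 0 -> (forall g1 g2, P g1 -> P g2 -> P (g1 + g2)) ->
  (forall c a, P << c *g a >>) -> forall g, P g.
Proof. by move=> P0 PD PU g; rewrite [g]monalgE; apply: big_ind. Qed.

Lemma twmulZl c g1 g2 : c *: twmul g1 g2 = twmul (c *: g1) g2.
Proof.
elim/malg_ind: g1 => [|g g' IH IH'|x a]; first by rewrite !(scaler0, twmul0g).
  by rewrite !(scalerDr, twmulDl) IH IH'.
elim/malg_ind: g2 => [|g g' IH IH'|y b]; first by rewrite !(scaler0, twmulg0).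
  by rewrite !(scalerDr, twmulDr) IH IH'.
by rewrite !(malg_scaleU, twmulUU) !mulrA.
Qed.

Lemma twmulZr c g1 g2 : c *: twmul g1 g2 = twmul g1 (c *: g2).
Proof.
elim/malg_ind: g1 => [|g g' IH IH'|x a]; first by rewrite !(scaler0, twmul0g).
  by rewrite !(scalerDr, twmulDl) IH IH'.
elim/malg_ind: g2 => [|g g' IH IH'|y b]; first by rewrite !(scaler0, twmulg0).
  by rewrite !(scalerDr, twmulDr) IH IH'.
by rewrite !(malg_scaleU, twmulUU) !mulrA (mulrC c).
Qed.

Hypothesis w0l : forall a, w 0 a = 1.
Hypothesis w0r : forall a, w a 0 = 1.
Hypothesis wA : forall a b d, w b d * w a (b + d) = w a b * w (a + b) d.

Lemma twmulA : associative twmul.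
Proof.
move=> g1 g2 g3.
elim/malg_ind: g1 => [|g g' IH IH'|x a]; first by rewrite !twmul0g.
  by rewrite !twmulDl IH IH'.
elim/malg_ind: g2 => [|g g' IH IH'|y b]; first by rewrite !(twmul0g, twmulg0).
  by rewrite !(twmulDl, twmulDr) IH IH'.
elim/malg_ind: g3 => [|g g' IH IH'|z d]; first by rewrite !twmulg0.
  by rewrite !twmulDr IH IH'.
rewrite !twmulUU addrA; congr << _ *g _ >>.
rewrite !mulrA -[LHS]mulrA wA mulrA; congr (_ * _).
by rewrite mulrAC.
Qed.

Lemma twmul1g : left_id << 0 >> twmul.
Proof.
elim/malg_ind => [|g g' IH IH'|x a]; first by rewrite twmulg0.
  by rewrite twmulDr IH IH'.
by rewrite twmulUU w0l mulr1 mul1r add0r.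
Qed.

Lemma twmulg1 : right_id << 0 >> twmul.
Proof.
elim/malg_ind => [|g g' IH IH'|x a]; first by rewrite twmul0g.
  by rewrite twmulDl IH IH'.
by rewrite twmulUU w0r !mulr1 addr0.
Qed.

Lemma twone_neq0 : << 0 >> != 0 :> {malg K[V]}.
Proof. by rewrite monalgU_eq0 oner_eq0. Qed.

End TwistedProduct.

Definition bform m (Lam : 'M[int]_m) (a b : 'cV[int]_m) : int :=
  (a^T *m Lam *m b) 0 0.

Section BForm.
Context m (Lam : 'M[int]_m).
Implicit Types a b c : 'cV[int]_m.

Lemma bformDl a b c : bform Lam (a + b) c = bform Lam a c + bform Lam b c.
Proof. by rewrite /bform raddfD /= !mulmxDl mxE. Qed.

Lemma bformDr a b c : bform Lam a (b + c) = bform Lam a b + bform Lam a c.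
Proof. by rewrite /bform mulmxDr mxE. Qed.

Lemma bform0l a : bform Lam 0 a = 0.
Proof. by rewrite /bform trmx0 !mul0mx mxE. Qed.

Lemma bform0r a : bform Lam a 0 = 0.
Proof. by rewrite /bform mulmx0 mxE. Qed.

End BForm.

(* Lam does not occur in the carrier; it selects the product. *)
Definition qtorus (K : qfield) m (Lam : 'M[int]_m) := {malg K['cV[int]_m]}.

(* The operations are locked because conversion is very slow on free modules  *)
(* over a type of matrices.                                                   *)
HB.lock Definition tscale (K : qfield) m (Lam : 'M[int]_m) (c : K)
  (g : qtorus K Lam) : qtorus K Lam := (c *: g : {malg K['cV[int]_m]}).

HB.lock Definition tmul (K : qfield) m (Lam : 'M[int]_m)
    (g1 g2 : qtorus K Lam) : qtorus K Lam :=
  twmul (fun a b => qh K ^ bform Lam a b) g1 g2.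

HB.lock Definition tX (K : qfield) m (Lam : 'M[int]_m) (a : 'cV[int]_m) :
  qtorus K Lam := << a >>.

Arguments tX {K m Lam}.

Section QuantumTorus.
Context (K : qfield) (m : nat) (Lam : 'M[int]_m).
Local Notation T := (qtorus K Lam).
Local Notation twist := (fun a b => qh K ^ bform Lam a b).

Let twist0l a : twist 0 a = 1.
Proof. by rewrite /= bform0l expr0z. Qed.

Let twist0r a : twist a 0 = 1.
Proof. by rewrite /= bform0r expr0z. Qed.

Let twistA a b c : twist b c * twist a (b + c) = twist a b * twist (a + b) c.
Proof.
rewrite /= -!expfzDr ?qh_neq0 // bformDl bformDr.
by congr (_ ^ _); rewrite addrC -addrA.
Qed.

HB.instance Definition _ := GRing.Zmodule.on T.

Fact tscaleA c1 c2 (g : T) : tscale c1 (tscale c2 g) = tscale (c1 * c2) g.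
Proof. by rewrite tscale.unlock scalerA. Qed.

Fact tscale1r : left_id 1 (@tscale K m Lam).
Proof. by move=> g; rewrite tscale.unlock scale1r. Qed.

Fact tscaleDr : right_distributive (@tscale K m Lam) +%R.
Proof. by move=> c g1 g2; rewrite tscale.unlock; apply: scalerDr. Qed.

Fact tscaleDl (g : T) : {morph (fun c => tscale c g) : c1 c2 / c1 + c2}.
Proof. by move=> c1 c2; rewrite tscale.unlock; apply: scalerDl. Qed.

HB.instance Definition _ := GRing.Zmodule_isLmodule.Build K T
  tscaleA tscale1r tscaleDr tscaleDl.

Fact tmulA : associative (@tmul K m Lam).
Proof. by rewrite tmul.unlock; apply: (twmulA twistA). Qed.

Fact tmul1g : left_id (tX 0) (@tmul K m Lam).
Proof. by rewrite tmul.unlock tX.unlock; apply: (twmul1g twist0l). Qed.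

Fact tmulg1 : right_id (tX 0) (@tmul K m Lam).
Proof. by rewrite tmul.unlock tX.unlock; apply: (twmulg1 twist0r). Qed.

Fact tmulDl : left_distributive (@tmul K m Lam) +%R.
Proof. by rewrite tmul.unlock; apply: (@twmulDl _ _ twist). Qed.

Fact tmulDr : right_distributive (@tmul K m Lam) +%R.
Proof. by rewrite tmul.unlock; apply: (@twmulDr _ _ twist). Qed.

Fact tone_neq0 : tX 0 != 0 :> T.
Proof. by rewrite tX.unlock; apply: twone_neq0. Qed.

HB.instance Definition _ := GRing.Zmodule_isNzRing.Build T
  tmulA tmul1g tmulg1 tmulDl tmulDr tone_neq0.

Fact tscaleAl c (g1 g2 : T) : c *: (g1 * g2) = c *: g1 * g2.
Proof.
by rewrite /GRing.scale /GRing.mul /= tscale.unlock tmul.unlock; apply: twmulZl.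
Qed.

HB.instance Definition _ := GRing.Lmodule_isLalgebra.Build K T tscaleAl.

Fact tscaleAr c (g1 g2 : T) : c *: (g1 * g2) = g1 * (c *: g2).
Proof.
by rewrite /GRing.scale /GRing.mul /= tscale.unlock tmul.unlock; apply: twmulZr.
Qed.

HB.instance Definition _ := GRing.Lalgebra_isAlgebra.Build K T tscaleAr.

Lemma tXM a b : tX a * tX b = qh K ^ bform Lam a b *: tX (a + b) :> T.
Proof.
rewrite /GRing.scale /GRing.mul /= tscale.unlock tmul.unlock tX.unlock.
by rewrite twmulUU !mul1r malg_scaleU mulr1.
Qed.

Lemma tXE (g : T) : g = \sum_(a <- msupp g) g@_a *: tX a.
Proof.
rewrite /GRing.scale /= tscale.unlock tX.unlock [LHS]monalgE.
by apply: eq_bigr => a _; rewrite malg_scaleU mulr1.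
Qed.

End QuantumTorus.

Definition evec m (i : 'I_m) : 'cV[int]_m := delta_mx i 0.

Definition pospart m (b : 'cV[int]_m) : 'cV[int]_m :=
  \col_i Num.max (b i 0) 0.

(* The data (B~, Lambda) of a seed of rank n with p frozen variables; the     *)
(* cluster of the seed generating the algebra is (X^{e_1}, ..., X^{e_m}).     *)
Record qseed (n p : nat) := QSeed {
  extmx : 'M[int]_(n + p, n);
  qform : 'M[int]_(n + p)
}.

Definition exmx n p (S : qseed n p) : 'M[int]_n := usubmx (extmx S).

(* No nonempty proper set of indices is disconnected from its complement by   *)
(* the nonzero entries of M; column j carries the row index iota j.           *)
Definition indecomposable m n (iota : 'I_n -> 'I_m) (M : 'M[int]_(m, n)) :=
  forall A : {set 'I_m}, A != set0 -> A != setT ->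
  exists i j, (i \in A) != (iota j \in A) /\ M i j != 0.

Definition quantum_seed n p (S : qseed n p) : Prop :=
  [/\ exists d : 'rV[int]_n, [/\ forall i, 0 < d 0 i,
        (diag_mx d *m exmx S)^T = - (diag_mx d *m exmx S) &
        (extmx S)^T *m qform S = row_mx (diag_mx d) 0],
      (qform S)^T = - qform S,
      indecomposable (@lshift n p) (extmx S) &
      indecomposable id (exmx S)].

Section Mutation.
Context (n p : nat).
Implicit Types (S : qseed n p) (k : 'I_n).

Definition mut_extmx S k : 'M[int]_(n + p, n) :=
  let b := extmx S in
  \matrix_(j, i)
    if (i == k) || (j == lshift p k) then - b j i
    else b j i + Num.max (- b j k) 0 * b (lshift p k) i
               + b j k * Num.max (b (lshift p k) i) 0.

Definition mut_qform S k : 'M[int]_(n + p) :=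
  let kk := lshift p k in
  let lam j := bform (qform S) (evec j) (- evec kk + pospart (col k (extmx S))) in
  \matrix_(j, i)
    if j == kk then (if i == kk then 0 else - lam i)
    else if i == kk then lam j else qform S j i.

Definition mut_seed S k : qseed n p := QSeed (mut_extmx S k) (mut_qform S k).

Definition mut_var K S k : qtorus K (qform S) :=
  tX (- evec (lshift p k) + pospart (col k (extmx S)))
  + tX (- evec (lshift p k) + pospart (- col k (extmx S))).

End Mutation.

(* If x is a family q-commuting as prescribed by Lam, [clmon x Lam a] is, for *)
(* a >= 0, its normalized monomial                                            *)
(*   q^{-1/2 \sum_(i < j) a_i a_j Lam_ij} x_1^{a_1} ... x_m^{a_m},            *)
(* that is "X^a" for the cluster x, and [cleval] is its linear extension to   *)
(* the span of the X^a with a >= 0; other a are never used below.             *)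
Definition clmon (K : qfield) m (T : algType K) (x : 'I_m -> T)
    (Lam : 'M[int]_m) (a : 'cV[int]_m) : T :=
  qh K ^ (- \sum_(i < m) \sum_(j < m | (i < j)%N) a i 0 * a j 0 * Lam i j)
  *: \prod_(i < m) x i ^+ absz (a i 0).

Definition cleval (K : qfield) m (T : algType K) (x : 'I_m -> T)
    (Lam : 'M[int]_m) (g : qtorus K Lam) : T :=
  \sum_(a <- msupp g) g@_a *: clmon x Lam a.

(* The seeds obtained from S by iterated mutation, with their clusters as     *)
(* elements of the quantum torus of S (quantum Laurent phenomenon). The new   *)
(* variable is x'_k = [mut_var K S' k], which lives in the quantum torus of   *)
(* S'; it is located in the torus of S by the equation                        *)
(*   x_k x'_k = X^{e_k} (X^{-e_k + [b_k]_+} + X^{-e_k + [-b_k]_+}),           *)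
(* whose right-hand side has nonnegative exponents only. As the torus of S    *)
(* is a domain, this determines x'_k.                                         *)
Inductive mut_class (K : qfield) n p (S : qseed n p) :
    ('I_(n + p) -> qtorus K (qform S)) -> qseed n p -> Prop :=
| mut_class_init : mut_class (fun i => tX (evec i)) S
| mut_class_step x S' k x' of mut_class x S' &
    (forall j, j != lshift p k -> x' j = x j) &
    x (lshift p k) * x' (lshift p k)
      = cleval x (tX (evec (lshift p k)) * mut_var K S' k) :
  mut_class x' (mut_seed S' k).

Inductive in_qcluster (K : qfield) n p (S : qseed n p) :
    qtorus K (qform S) -> Prop :=
| in_qcluster_frozen (a : 'cV[int]_p) : in_qcluster (tX (col_mx 0 a))
| in_qcluster_var x S' i of mut_class x S' : in_qcluster (x (lshift p i))
| in_qclusterD u v of in_qcluster u & in_qcluster v : in_qcluster (u + v)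
| in_qclusterM u v of in_qcluster u & in_qcluster v : in_qcluster (u * v)
| in_qclusterZ c u of in_qcluster u : in_qcluster (c *: u).

Definition qcluster_pred (K : qfield) n p (S : qseed n p) :
  {pred qtorus K (qform S)} := fun u => `[< in_qcluster u >].

Lemma qclusterP (K : qfield) n p (S : qseed n p) u :
  reflect (in_qcluster u) (u \in @qcluster_pred K n p S).
Proof. exact: asboolP. Qed.

Lemma qcluster_closed (K : qfield) n p (S : qseed n p) :
  GRing.subsemialg_closed (@qcluster_pred K n p S).
Proof.
have q0 : @in_qcluster K n p S 1.
  by have := @in_qcluster_frozen K n p S 0; rewrite col_mx0.
split.
- exact/qclusterP.
- split; last by move=> u v /qclusterP qu /qclusterP qv; exact/qclusterP/in_qclusterD.
  by apply/qclusterP; rewrite -(scale0r 1); apply: in_qclusterZ.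
- by move=> c u /qclusterP qu; exact/qclusterP/in_qclusterZ.
- by move=> u v /qclusterP qu /qclusterP qv; exact/qclusterP/in_qclusterM.
Qed.

HB.instance Definition _ (K : qfield) n p (S : qseed n p) :=
  GRing.isSubalgClosed.Build K (qtorus K (qform S))
    (@qcluster_pred K n p S) (@qcluster_closed K n p S).

Record qcluster (K : qfield) n p (S : qseed n p) := QCluster {
  qcval : qtorus K (qform S);
  qcvalP : qcval \in @qcluster_pred K n p S
}.

Section QClusterAlgebra.
Context (K : qfield) (n p : nat) (S : qseed n p).

HB.instance Definition _ := [isSub for @qcval K n p S].
HB.instance Definition _ := [Choice of qcluster K S by <:].
HB.instance Definition _ := [SubChoice_isSubAlgebra of qcluster K S by <:].

Lemma initvarP (i : 'I_(n + p)) : tX (evec i) \in @qcluster_pred K n p S.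
Proof.
apply/qclusterP; rewrite -(splitK i); case: (split i) => j /=.
  exact: (in_qcluster_var j (mut_class_init K S)).
by rewrite /evec delta_mx_dshift; apply: in_qcluster_frozen.
Qed.

Definition initvar (i : 'I_(n + p)) : qcluster K S := QCluster (initvarP i).

End QClusterAlgebra.

Definition quasi_hom (K : qfield) n p p' (S : qseed n p) (S' : qseed n p')
    (f : {lrmorphism qcluster K S -> qcluster K S'}) : Prop :=
  [/\ exmx S = exmx S',
      exists h : 'I_n -> 'cV[int]_(n + p'), forall i, usubmx (h i) = 0 /\
        qcval (f (initvar K S (lshift p i))) = tX (evec (lshift p' i) + h i),
      exists l : 'I_p -> 'cV[int]_(n + p'), forall j, usubmx (l j) = 0 /\
        qcval (f (initvar K S (rshift n j))) = tX (l j) &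
      exists F : {lrmorphism qtorus K (qform S) -> qtorus K (qform S')},
        (forall u, F (qcval u) = qcval (f u)) /\
        (forall i, F (tX (col i (extmx S))) = tX (col i (extmx S')))].

Definition induces_quasi_hom (K : qfield) n p p' (S : qseed n p)
    (S' : qseed n p') (f : 'I_(n + p) -> qtorus K (qform S')) : Prop :=
  exists F : {lrmorphism qcluster K S -> qcluster K S'},
    (forall i, qcval (F (initvar K S i)) = f i) /\ quasi_hom F.

Arguments induces_quasi_hom {K n p p'} S S' f.

(* Main.v *)
Require Import Defs.
From HB Require Import structures.
From mathcomp Require Import all_boot all_order all_algebra.
From mathcomp Require Import reals complex finmap monalg.
From mathcomp Require Import zify ring.

(* Condition 4 says that X^a |-> X'^(R a) is a morphism phi of quantum tori,  *)
(* and any morphism with the prescribed values on the variables has this form *)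
(* because q is not a root of unity; this gives 3 and 4 from the existence of *)
(* f.                                                                         *)
(* Conversely, phi must be shown to map one cluster algebra to the other. Let *)
(* E be the involution e_k |-> - e_k + [b_k]_+ attached to a mutation: it     *)
(* transforms Lambda into E^T Lambda E, and B~ into E B~ followed by column   *)
(* operations depending only on B. Thus if M satisfies 3 and 4 for a pair of  *)
(* seeds, then E' M E does for the mutated pair. By induction                 *)
(* phi(X_t^a) = X'_t^(M_t a), so each cluster variable is sent to the         *)
(* corresponding one times a frozen monomial: phi carries the exchange        *)
(* relations, solved in T(Sigma), to those of Sigma'. The new variable        *)
(* q-commutes with the other ones because x_k can be cancelled, the quantum   *)
(* torus being a domain.                                                      *)

Set Implicit Arguments.
Unset Strict Implicit.
Unset Printing Implicit Defensive.

Import Order.TTheory GRing.Theory Num.Theory.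
Local Open Scope ring_scope.

(** In one direction, [form_of_morphism] reads condition 4 off the q-commutation exponents of the
    images of the variables, [morphism_monomial] extends X^a |-> X'^(R a) from the basis vectors to
    all a, and condition 3 is the equality of exponents in the images of the X^{b_i}. In the other
    direction, [monomial_morphism] builds phi on the tori. The key step is [transfer_exchange]:
    divided by a suitable frozen monomial, the image of a mutated variable solves the exchange
    relation of the other seed. [mut_class_transfer] iterates this along mutations, and
    [qcluster_restrict] then restricts phi to the cluster algebras. *)

Lemma Cq_qh_free (R : realType) (z : int) : qh (Cq R) ^ z = 1 -> z = 0.
Proof.
have nat_case (k : nat) : qh (Cq R) ^ (k%:Z) = 1 -> k = 0%N.
  rewrite -exprnP /= -rmorphXn -(rmorph1 (@tofrac {poly R[i]})).
  move=> /eqP; rewrite tofrac_eq => /eqP.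
  move=> /(congr1 (fun q : {poly R[i]} => size q)).
  by rewrite size_polyXn size_poly1 => -[].
case: z => k; first by move/nat_case->.
move=> /(congr1 GRing.inv); rewrite invr1 [X in X^-1]/exprz invrK.
by move/(nat_case k.+1).
Qed.

(** * The quantum torus is a domain *)

Section UniqueSum.
Variable m : nat.
Implicit Types (A B : seq 'cV[int]_m) (a b : 'cV[int]_m).

Lemma seq_max_coord A (i : 'I_m) : A != [::] ->
  exists2 a, a \in A & forall a', a' \in A -> a' i 0 <= a i 0.
Proof.
elim: A => // a A IH _; have [A0|/IH[b bA bmax]] := eqVneq A [::].
  by exists a; rewrite A0 ?mem_head // => a'; rewrite inE => /eqP->.
have [ab|ba] := leP (a i 0) (b i 0).
  exists b; rewrite ?inE ?bA ?orbT // => a'; rewrite inE => /orP[/eqP->//|].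
  exact: bmax.
exists a; rewrite ?mem_head // => a'; rewrite inE => /orP[/eqP->//|/bmax].
by move=> /le_trans; apply; apply: ltW.
Qed.

(* Restrict A and B to their elements of maximal i-th coordinate, for each i  *)
(* in turn.                                                                   *)
Lemma unique_sum_on (s : seq 'I_m) A B : A != [::] -> B != [::] ->
  exists a b, [/\ a \in A, b \in B & forall a' b', a' \in A -> b' \in B ->
    {in s, forall i, a' i 0 + b' i 0 = a i 0 + b i 0} ->
    {in s, forall i, a' i 0 = a i 0 /\ b' i 0 = b i 0}].
Proof.
elim: s A B => [|i s IH] A B A0 B0.
  case: A A0 => // a A _; case: B B0 => // b B _.
  by exists a, b; rewrite !mem_head.
have [a aA amax] := seq_max_coord i A0.
have [b bB bmax] := seq_max_coord i B0.
pose A1 := [seq a' : 'cV[int]_m <- A | a' i 0 == a i 0].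
pose B1 := [seq b' : 'cV[int]_m <- B | b' i 0 == b i 0].
have aA1 : a \in A1 by rewrite mem_filter eqxx.
have bB1 : b \in B1 by rewrite mem_filter eqxx.
have [||a1 [b1 []]] := IH A1 B1; [by case: (A1) aA1|by case: (B1) bB1|].
rewrite !mem_filter => /andP[/eqP a1i a1A] /andP[/eqP b1i b1B] uniq1.
exists a1, b1; split=> // a' b' a'A b'B sumE.
have := sumE i (mem_head _ _); rewrite a1i b1i => sumi.
have [a'i b'i] : a' i 0 = a i 0 /\ b' i 0 = b i 0.
  by have := amax _ a'A; have := bmax _ b'B; lia.
move=> j; rewrite inE => /orP[/eqP->|js]; first by rewrite a1i b1i.
apply: uniq1 => //; rewrite ?mem_filter ?a'i ?b'i ?eqxx //.
by move=> l ls; apply: sumE; rewrite inE ls orbT.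
Qed.

Lemma unique_sum A B : A != [::] -> B != [::] ->
  exists a b, [/\ a \in A, b \in B & forall a' b', a' \in A -> b' \in B ->
    a' + b' = a + b -> a' = a /\ b' = b].
Proof.
move=> A0 B0; have [a [b [aA bB uab]]] := unique_sum_on (enum 'I_m) A0 B0.
exists a, b; split=> // a' b' a'A b'B sumE.
have E i : a' i 0 = a i 0 /\ b' i 0 = b i 0.
  apply: (uab a' b') => //; last by rewrite mem_enum.
  by move=> j _; move/colP/(_ j): sumE; rewrite !mxE.
by split; apply/colP => i; case: (E i).
Qed.
End UniqueSum.

Lemma big_seq_single (V : nmodType) (I : eqType) (r : seq I) (a : I)
    (F : I -> V) : uniq r -> a \in r ->
  (forall i, i \in r -> i != a -> F i = 0) -> \sum_(i <- r) F i = F a.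
Proof.
move=> ur ar F0; rewrite (bigD1_seq a) //= big1_seq ?addr0 // => i /andP[ia ir].
exact: F0.
Qed.

(** No other pair of exponents contributes to the coefficient at a + b, so nothing can cancel
    there. *)
Lemma twmul_coeff_unique (K : fieldType) (V : zmodType) (w : V -> V -> K)
    (u v : {malg K[V]}) (a b : V) :
  a \in msupp u -> b \in msupp v ->
  (forall a' b', a' \in msupp u -> b' \in msupp v ->
     a' + b' = a + b -> a' = a /\ b' = b) ->
  (twmul w u v)@_(a + b) = u@_a * v@_b * w a b.
Proof.
move=> aA bB uab; rewrite /twmul raddf_sum /=.
rewrite (big_seq_single (fset_uniq _) aA) => [|a' a'A a'a].
  rewrite raddf_sum /= (big_seq_single (fset_uniq _) bB) => [|b' b'B b'b].
    by rewrite mcoeffU eqxx.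
  rewrite mcoeffU; case: eqP => // /uab.
  by move=> /(_ aA b'B)[_ E]; rewrite E eqxx in b'b.
rewrite raddf_sum /= big_seq big1 // => b' b'B.
rewrite mcoeffU; case: eqP => // /uab.
by move=> /(_ a'A b'B)[E _]; rewrite E eqxx in a'a.
Qed.

Section TorusTheory.
Context (K : qfield) (m : nat) (Lam : 'M[int]_m).
Local Notation T := (qtorus K Lam).
Local Open Scope fset_scope. Local Open Scope ring_scope.

Lemma tcoeffZ c (u : T) a : (c *: u)@_a = c * u@_a.
Proof. by rewrite /GRing.scale /= tscale.unlock mcoeffZ. Qed.

Lemma tcoeffX a b : (tX a : T)@_b = (a == b)%:R.
Proof. by rewrite tX.unlock mcoeffU. Qed.

Lemma tX_inj : injective (@tX K m Lam).
Proof.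
move=> a b /(congr1 (fun u : T => u@_b)); rewrite !tcoeffX eqxx.
by case: eqP => // _ /eqP; rewrite eq_sym oner_eq0.
Qed.

Lemma tX_neq0 a : tX a != 0 :> T.
Proof.
apply/eqP => /(congr1 (fun u : T => u@_a)); rewrite tcoeffX eqxx mcoeff0.
by apply/eqP; rewrite oner_eq0.
Qed.

Lemma qhz_neq0 z : qh K ^ z != 0.
Proof. by rewrite expfz_neq0 ?qh_neq0. Qed.

Lemma torus_integral (u v : T) : u * v = 0 -> u != 0 -> v = 0.
Proof.
move=> uv0 u0; apply/eqP/negPn/negP => v0.
have supp0 (g : T) : g != 0 -> (msupp g : seq _) != [::].
  move=> g0; apply/eqP => s0; case/negP: g0; apply/eqP.
  by rewrite [LHS]tXE s0 big_nil.
have [a [b [aA bB uab]]] := unique_sum (supp0 _ u0) (supp0 _ v0).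
have : (u * v)@_(a + b) = u@_a * v@_b * qh K ^ bform Lam a b.
  by rewrite {1}/GRing.mul /= tmul.unlock (twmul_coeff_unique _ aA bB uab).
rewrite uv0 mcoeff0 => /esym/eqP; rewrite !mulf_eq0 (negPf (qhz_neq0 _)) orbF.
by rewrite !mcoeff_eq0 aA bB.
Qed.

End TorusTheory.

(** * Linear extension from monomials, and bilinear forms *)

Section LinearExtension.
Context (K : qfield) (m : nat) (Lam : 'M[int]_m) (V : lmodType K).
Local Notation T := (qtorus K Lam).
Local Open Scope fset_scope. Local Open Scope ring_scope.

(** [cleval x Lam] is convertible to [linext (clmon x Lam)], so the linearity proved here lets
    exchange relations be evaluated term by term. *)
Definition linext (phi : 'cV[int]_m -> V) (g : T) : V :=
  \sum_(a <- msupp g) g@_a *: phi a.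

Lemma linextw (phi : 'cV[int]_m -> V) (d : {fset 'cV[int]_m}) (g : T) :
  msupp g `<=` d -> linext phi g = \sum_(a <- d) g@_a *: phi a.
Proof.
move=> le_gd; apply: big_fset_incl => // a _ /mcoeff_outdom ->.
by rewrite scale0r.
Qed.

Lemma linextD phi : {morph linext phi : u v / u + v}.
Proof.
move=> u v; rewrite (linextw _ (msuppD_le _ _)).
rewrite (linextw _ (fsubsetUl _ (msupp v))) (linextw _ (fsubsetUr (msupp u) _)).
by rewrite -big_split; apply: eq_bigr => a _; rewrite mcoeffD scalerDl.
Qed.

Lemma linextZ phi c (u : T) : linext phi (c *: u) = c *: linext phi u.
Proof.
rewrite [in RHS](linextw _ (fsubset_refl _)) (@linextw _ (msupp u)).
  by rewrite scaler_sumr; apply: eq_bigr => a _; rewrite tcoeffZ scalerA.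
apply/fsubsetP => a; rewrite -!mcoeff_neq0 tcoeffZ.
by apply: contraNneq => ->; rewrite mulr0.
Qed.

Lemma linextX phi a : linext phi (tX a) = phi a.
Proof.
rewrite (@linextw _ [fset a]); last by rewrite tX.unlock msuppU_le.
by rewrite big_seq_fset1 tcoeffX eqxx scale1r.
Qed.

End LinearExtension.

Section BFormTheory.
Context m (Lam : 'M[int]_m).
Implicit Types a b : 'cV[int]_m.

Lemma bformZl c a b : bform Lam (c *: a) b = c * bform Lam a b.
Proof. by rewrite /bform linearZ /= -!scalemxAl mxE. Qed.

Lemma bformZr c a b : bform Lam a (c *: b) = c * bform Lam a b.
Proof. by rewrite /bform -scalemxAr mxE. Qed.

Lemma bformNl a b : bform Lam (- a) b = - bform Lam a b.
Proof. by rewrite -scaleN1r bformZl mulN1r. Qed.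

Lemma bformNr a b : bform Lam a (- b) = - bform Lam a b.
Proof. by rewrite -scaleN1r bformZr mulN1r. Qed.

Lemma bformMM m' (M : 'M[int]_(m, m')) (a b : 'cV[int]_m') :
  bform (M^T *m Lam *m M) a b = bform Lam (M *m a) (M *m b).
Proof. by rewrite /bform trmx_mul !mulmxA. Qed.

Lemma bform_evec i j : bform Lam (evec i) (evec j) = Lam i j.
Proof. by rewrite /bform /evec trmx_delta -rowE -colE !mxE. Qed.

Lemma bform_skew a b : Lam^T = - Lam -> bform Lam a b = - bform Lam b a.
Proof.
move=> skew; rewrite /bform -[RHS]mulN1r.
rewrite -[in LHS](trmxK (a^T *m Lam *m b)) mxE !trmx_mul trmxK skew.
by rewrite mulNmx mulmxN mulmxA mxE mulN1r.
Qed.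

Lemma bform_diag a : Lam^T = - Lam -> bform Lam a a = 0.
Proof. by move/(bform_skew a a); lia. Qed.

End BFormTheory.

Definition bformE := (bformDl, bformDr, bformNl, bformNr, bformZl, bformZr).

Lemma form_ext m (A B : 'M[int]_m) :
  (forall i j, bform A (evec i) (evec j) = bform B (evec i) (evec j)) -> A = B.
Proof.
by move=> AB; apply/matrixP => i j; have := AB i j; rewrite !bform_evec.
Qed.

Lemma vec_sum m (a : 'cV[int]_m) : a = \sum_i a i 0 *: evec i.
Proof.
apply/colP => j; rewrite summxE (bigD1 j) //= big1 ?addr0.
  by rewrite /evec !mxE !eqxx mulr1.
by move=> i ij; rewrite /evec !mxE eq_sym (negPf ij) mulr0.
Qed.

(** * Compatible pairs and their mutation *)

Section CompatiblePair.
Context (n p : nat).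
Implicit Types (S : qseed n p) (k : 'I_n) (a b : 'cV[int]_(n + p)).

(** Frozen coordinates are left free because frozen variables stay invertible. *)
Definition nonneg_top a := forall i : 'I_n, 0 <= a (lshift p i) 0.

Lemma nonneg_topD a b : nonneg_top a -> nonneg_top b -> nonneg_top (a + b).
Proof. by move=> a0 b0 i; rewrite mxE addr_ge0. Qed.

Lemma nonneg_topZ c a : 0 <= c -> nonneg_top a -> nonneg_top (c *: a).
Proof. by move=> c0 a0 i; rewrite mxE mulr_ge0. Qed.

Lemma nonneg_top_evec i : nonneg_top (evec i).
Proof. by move=> j; rewrite /evec mxE andbT; case: (_ == _). Qed.

Lemma nonneg_top_pospart a : nonneg_top (pospart a).
Proof. by move=> j; rewrite mxE le_max lexx orbT. Qed.

Lemma nonneg_top_frozen a : usubmx a = 0 -> nonneg_top a.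
Proof. by move=> a0 i; move/colP/(_ i): a0; rewrite !mxE => ->. Qed.

(** The equation B~^T Lambda = (D, 0) tested on vectors; mutation preserves it with the same D. *)
Definition compatible (d : 'rV[int]_n) S : Prop :=
  [/\ forall i, 0 < d 0 i, (qform S)^T = - qform S &
      forall i a,
        bform (qform S) (col i (extmx S)) a = d 0 i * a (lshift p i) 0].

Lemma seed_compatible S : quantum_seed S -> exists d, compatible d S.
Proof.
case=> -[d [d_gt0 _ BL]] skew _ _; exists d; split=> // i a.
rewrite /bform tr_col -!row_mul BL -{1}(vsubmxK a) mul_row_col mul0mx addr0.
by rewrite mul_diag_mx !mxE.
Qed.
End CompatiblePair.

Section MutationMatrix.
Context (n p : nat).
Implicit Types (S : qseed n p) (k : 'I_n) (a b : 'cV[int]_(n + p)).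
Local Notation ek k := (evec (lshift p k)).

(* [mutmx S k] is the involution E with E e_k = - e_k + [b_k]_+ and           *)
(* E e_j = e_j otherwise, by which a mutation transforms the exponents.       *)
Definition mutmx S k : 'M[int]_(n + p) :=
  1%:M + (pospart (col k (extmx S)) - 2 *: ek k) *m (ek k)^T.

Lemma mutmxE S k a : mutmx S k *m a =
  a + a (lshift p k) 0 *: (pospart (col k (extmx S)) - 2 *: ek k).
Proof.
rewrite mulmxDl mul1mx -mulmxA; congr (_ + _).
rewrite /evec trmx_delta -rowE; apply/colP => j.
by rewrite mxE big_ord1 !mxE mulrC.
Qed.

Lemma mutmx_fix S k a : a (lshift p k) 0 = 0 -> mutmx S k *m a = a.
Proof. by move=> a0; rewrite mutmxE a0 scale0r addr0. Qed.

Lemma mutmx_evec S k :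
  mutmx S k *m ek k = - ek k + pospart (col k (extmx S)).
Proof.
by apply/colP => i; rewrite mutmxE /evec !mxE !eqxx !andbT mul1r; ring.
Qed.

Lemma evec_diff i j : i != j -> (@evec (n + p) i) j 0 = 0.
Proof. by move=> ij; rewrite /evec mxE eq_sym (negPf ij). Qed.

Section Compatible.
Context (d : 'rV[int]_n) (S : qseed n p) (cS : compatible d S).

(** Evaluate the skew form on the pair of columns b_i, b_j in both orders. *)
Lemma compatible_skew_symm i j :
  d 0 i * extmx S (lshift p i) j = - (d 0 j * extmx S (lshift p j) i).
Proof.
have [_ skew dE] := cS.
have := bform_skew (col i (extmx S)) (col j (extmx S)) skew.
by rewrite !dE ![col _ _ _ _]mxE.
Qed.

Lemma compatible_diag k : extmx S (lshift p k) k = 0.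
Proof.
have [d_gt0 _ _] := cS; have := compatible_skew_symm k k; have := d_gt0 k.
by nia.
Qed.

(** Since b_kk = 0, the k-th row of E is minus that of the identity, which makes E an involution. *)
Lemma mutmxK k : mutmx S k *m mutmx S k = 1%:M.
Proof.
rewrite {1}/mutmx mulmxDl mul1mx -mulmxA.
have -> : (ek k)^T *m mutmx S k = - (ek k)^T.
  rewrite /mutmx mulmxDr mulmx1 mulmxA mulmxBr.
  suff [-> ->] : (ek k)^T *m pospart (col k (extmx S)) = 0 /\
      (ek k)^T *m (2 *: ek k) = 2%:M.
    rewrite sub0r mulNmx mul_scalar_mx scaler_nat mulr2n opprD addrA addrN.
    by rewrite sub0r.
  split; rewrite /evec trmx_delta -rowE; apply/matrixP => i j; rewrite !ord1.
    by rewrite !mxE compatible_diag maxxx.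
  by rewrite !mxE !eqxx.
by rewrite mulmxN /mutmx -addrA addrN addr0.
Qed.

Lemma mutmxKv k a : mutmx S k *m (mutmx S k *m a) = a.
Proof. by rewrite mulmxA mutmxK mul1mx. Qed.

Lemma mut_qformE k :
  mut_qform S k = (mutmx S k)^T *m qform S *m mutmx S k.
Proof.
have [_ skew _] := cS.
apply: form_ext => i j; rewrite bformMM bform_evec mxE.
have E l : l != lshift p k -> mutmx S k *m evec l = evec l.
  by move=> lk; rewrite mutmx_fix // evec_diff.
have [->|/E Ei] := eqVneq i; have [->|/E Ej] := eqVneq j.
- by rewrite bform_diag.
- by rewrite mutmx_evec Ej -bform_skew.
- by rewrite mutmx_evec Ei.
- by rewrite Ei Ej bform_evec.
Qed.

(** The column operations accompanying E involve only row k of B, hence coincide for two seeds with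
    the same exchange matrix. *)
Lemma mut_extmx_col k i : col i (mut_extmx S k) =
  if i == k then - col k (extmx S)
  else mutmx S k *m col i (extmx S)
       + Num.max (- extmx S (lshift p k) i) 0 *: col k (extmx S).
Proof.
have [->|ik] := eqVneq i k; first by apply/colP => j; rewrite !mxE eqxx.
apply/colP => j; rewrite mutmxE !mxE (negPf ik) /=.
have [->|jk] := eqVneq j (lshift p k); last first.
  have maxN (z : int) : Num.max (- z) 0 = Num.max z 0 - z by lia.
  by rewrite /= mulr0 !maxN; ring.
by rewrite compatible_diag maxxx eqxx mulr0 addr0 /=; ring.
Qed.

Lemma mut_compatible k : compatible d (mut_seed S k).
Proof.
have [d_gt0 skew dE] := cS; split=> //.
  rewrite /= mut_qformE !trmx_mul trmxK skew mulNmx mulmxN mulmxA //.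
move=> i a; rewrite /= mut_qformE bformMM mut_extmx_col.
have bkE : mutmx S k *m col k (extmx S) = col k (extmx S).
  by rewrite mutmx_fix // mxE compatible_diag.
rewrite (mutmxE S k a); set a' := a + _.
have a'E : forall j, a' (lshift p j) 0 = if j == k then - a (lshift p k) 0 else
  a (lshift p j) 0 + a (lshift p k) 0 * Num.max (extmx S (lshift p j) k) 0.
  move=> j; rewrite /a' !mxE /= eq_lshift; have [->|_] := eqVneq j k.
    by rewrite compatible_diag maxxx eqxx /=; ring.
  by rewrite /=; ring.
case: ifP => [/eqP ->|ik]; first by rewrite mulmxN bkE bformNl dE a'E eqxx; lia.
rewrite mulmxDr mutmxKv -scalemxAr bkE bformDl bformZl !dE !a'E eqxx ik.
have := compatible_skew_symm i k; have := d_gt0 i; have := d_gt0 k.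
set x := extmx S _ _; set y := extmx S _ _ => d1 d2 E.
(* This is the skew-symmetry of DB; positive factors pass through the positive part. *)
suff dyx : d 0 i * Num.max x 0 = Num.max (- y) 0 * d 0 k.
  by rewrite mulrDr (mulrCA (d 0 i)) dyx; ring.
rewrite mulrC !maxr_pMl ?ltW // !mul0r mulNr; congr (Num.max _ _); nia.
Qed.
End Compatible.
End MutationMatrix.

Section TorusCancel.
Context (K : qfield) (m : nat) (Lam : 'M[int]_m).
Implicit Types u v w : qtorus K Lam.

Lemma torus_lcancel u v w : u != 0 -> u * v = u * w -> v = w.
Proof.
move=> u0 uvw; apply/eqP; rewrite -subr_eq0; apply/eqP.
by apply: (torus_integral _ u0); rewrite mulrBr uvw subrr.
Qed.

Lemma torus_mul_neq0 u v : u != 0 -> v != 0 -> u * v != 0.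
Proof. by move=> u0; apply: contraNneq => /torus_integral->. Qed.

End TorusCancel.

Lemma expqhD (K : qfield) (a b : int) : qh K ^ a * qh K ^ b = qh K ^ (a + b).
Proof. by rewrite -expfzDr ?qh_neq0. Qed.

(** * Monomials in the variables of a seed *)

Section Frame.
Context (K : qfield) (n p : nat) (Lam0 : 'M[int]_(n + p)).
Implicit Types (Lam : 'M[int]_(n + p)) (S : qseed n p).
Local Notation T := (qtorus K Lam0).
Local Notation ek k := (evec (lshift p k)).

(* The monomials Y a = X_t^a of a seed t with form Lam, located in the torus  *)
(* of the initial seed. A negative power of a mutable variable of t need not  *)
(* exist there, whence the restriction to nonneg_top.                         *)
Record frame Lam (Y : 'cV[int]_(n + p) -> T) : Prop := Frame {
  frameM : forall a b, nonneg_top a -> nonneg_top b ->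
    Y a * Y b = qh K ^ bform Lam a b *: Y (a + b);
  frame_neq0 : forall a, nonneg_top a -> Y a != 0;
  frame_frozen : forall c, usubmx c = 0 -> Y c = tX c
}.

Lemma initial_frame : frame Lam0 (@tX K _ Lam0).
Proof. by split=> // *; [exact: tXM|exact: tX_neq0]. Qed.

Section FrameTheory.
Context (Lam : 'M[int]_(n + p)) (Y : 'cV[int]_(n + p) -> T).
Hypotheses (skew : Lam^T = - Lam) (fY : frame Lam Y).

Lemma frame0 : Y 0 = 1.
Proof. by rewrite (frame_frozen fY) //; apply/colP => i; rewrite !mxE. Qed.

Lemma frame_comm a b : nonneg_top a -> nonneg_top b ->
  Y a * Y b = qh K ^ (2 * bform Lam a b) *: (Y b * Y a).
Proof.
move=> a0 b0; rewrite !(frameM fY) // scalerA expqhD addrC; congr (_ ^ _ *: _).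
by rewrite (bform_skew b a skew); lia.
Qed.

Lemma frameX a j : nonneg_top a -> Y a ^+ j = Y (j%:Z *: a).
Proof.
move=> a0; elim: j => [|j IH]; first by rewrite scale0r frame0.
rewrite exprS IH (frameM fY) //; last exact: nonneg_topZ.
rewrite bformZr bform_diag // mulr0 expr0z scale1r; congr Y.
by rewrite -{1}(scale1r a) -scalerDl.
Qed.

(** Working with increasing lists lets the induction split off the smallest index, which pairs with
    all the later ones. *)
Lemma frame_prod (s : seq 'I_(n + p)) (c : 'cV[int]_(n + p)) :
  (forall i, 0 <= c i 0) -> path.sorted ltn (map val s) ->
  nonneg_top (\sum_(i <- s) c i 0 *: evec i) /\
  \prod_(i <- s) Y (c i 0 *: evec i) =
  qh K ^ (\sum_(i <- s) \sum_(j <- s | (i < j)%N) c i 0 * c j 0 * Lam i j)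
  *: Y (\sum_(i <- s) c i 0 *: evec i).
Proof.
move=> c0; elim: s => [_|i s IH].
  by rewrite !big_nil expr0z scale1r frame0; split=> // j; rewrite mxE.
rewrite /= path_sortedE; last exact: ltn_trans.
move=> /andP[/allP lt_i /IH[ns Es]].
have nce : nonneg_top (c i 0 *: evec i).
  by apply: nonneg_topZ => //; exact: nonneg_top_evec.
split; first by rewrite big_cons; apply: nonneg_topD.
rewrite !big_cons ltnn Es -scalerAr (frameM fY) // scalerA expqhD.
congr (qh K ^ _ *: _); rewrite addrC; congr (_ + _).
  rewrite bformZl /bform mulmx_sumr summxE big_distrr /=.
  rewrite [RHS]big_mkcond /=; apply: eq_big_seq => j js.
  have ij : (i < j)%N by apply: lt_i; rewrite map_f.
  rewrite ij.
  have := bform_evec Lam i j; rewrite /bform => <-.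
  by rewrite -scalemxAr mxE mulrA.
(* The head [i] is smaller than [j], so it adds nothing to the inner sum of [j]. *)
apply: eq_big_seq => j js; rewrite big_cons.
have ij : (i < j)%N by apply: lt_i; rewrite map_f.
by rewrite ltnNge ltnW.
Qed.

(** The normalizing power of q in [clmon] is the inverse of the one produced by [frame_prod]. *)
Lemma frame_clmon (x : 'I_(n + p) -> T) (a : 'cV[int]_(n + p)) :
  (forall i, x i = Y (evec i)) -> (forall i, 0 <= a i 0) -> clmon x Lam a = Y a.
Proof.
move=> xE a0; rewrite /clmon.
have -> : \prod_i x i ^+ absz (a i 0) = \prod_i Y (a i 0 *: evec i).
  apply: eq_bigr => i _; rewrite xE frameX; last exact: nonneg_top_evec.
  by rewrite gez0_abs.
have sorted_ord : path.sorted ltn (map val (index_enum 'I_(n + p))).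
  by rewrite [index_enum _]unlock -enumT val_enum_ord iota_ltn_sorted.
have [_ ->] := frame_prod a0 sorted_ord.
by rewrite scalerA expqhD addNr expr0z scale1r -vec_sum.
Qed.

End FrameTheory.

(** The product of X^{e_k} with [mut_var], expanded and read through Y: the exponents e_k cancel and
    survive only in the powers of q. *)
Definition exchange_rhs S (Y : 'cV[int]_(n + p) -> T) k : T :=
  let b := col k (extmx S) in
  qh K ^ bform (qform S) (ek k) (pospart b) *: Y (pospart b)
  + qh K ^ bform (qform S) (ek k) (pospart (- b)) *: Y (pospart (- b)).

Lemma cleval_exchange d S Y (x : 'I_(n + p) -> T) k :
  compatible d S -> frame (qform S) Y -> (forall i, x i = Y (evec i)) ->
  cleval x (tX (ek k) * mut_var K S k) = exchange_rhs S Y k.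
Proof.
move=> [_ skew _] fY xE; rewrite -[LHS]/(linext (clmon x (qform S)) _).
have pos_ge0 (a : 'cV[int]_(n + p)) i : 0 <= pospart a i 0.
  by rewrite mxE le_max lexx orbT.
rewrite /mut_var mulrDr !tXM linextD !linextZ !linextX !addrA !addrN !add0r.
rewrite !(frame_clmon skew fY xE) // !bformDr !bformNr bform_diag //.
by rewrite oppr0 !add0r.
Qed.

End Frame.

(** * Mutation of the monomials of a seed *)

Lemma pospart_sub m (b : 'cV[int]_m) : pospart b - pospart (- b) = b.
Proof. by apply/colP => i; rewrite !mxE; move: (b i 0) => x; lia. Qed.

Section FrameStep.
Context (K : qfield) (n p : nat) (Lam0 : 'M[int]_(n + p)).
Context (d : 'rV[int]_n) (S : qseed n p).
Context (Y : 'cV[int]_(n + p) -> qtorus K Lam0).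
Context (k : 'I_n) (z : qtorus K Lam0).
Hypothesis qh_free : forall j : int, qh K ^ j = 1 -> j = 0.
Hypotheses (cS : compatible d S) (fY : frame (qform S) Y).
Local Notation ek := (evec (lshift p k)).
Local Notation L := (qform S).
Local Notation L' := (mut_qform S k).
Local Notation bk := (col k (extmx S)).
Hypothesis Yz : Y ek * z = exchange_rhs S Y k.
Implicit Types (a r : 'cV[int]_(n + p)).

Let skew : L^T = - L. Proof. by case: cS. Qed.
Let skew' : L'^T = - L'. Proof. by case: (mut_compatible cS k). Qed.
Let ek_ge0 : nonneg_top ek. Proof. exact: nonneg_top_evec. Qed.
Let vp_ge0 : nonneg_top (pospart bk). Proof. exact: nonneg_top_pospart. Qed.
Let vm_ge0 : nonneg_top (pospart (- bk)). Proof. exact: nonneg_top_pospart. Qed.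

(** The two exponents differ by b_k, and Lambda(b_k, r) = d_k r_k = 0, so both terms q-commute with
    Y r with the same exponent. *)
Lemma exchange_rhs_comm r : nonneg_top r -> r (lshift p k) 0 = 0 ->
  exchange_rhs S Y k * Y r =
  qh K ^ (2 * bform L (pospart bk) r) *: (Y r * exchange_rhs S Y k).
Proof.
move=> r0 rk; have [_ _ dE] := cS.
have vmE : bform L (pospart (- bk)) r = bform L (pospart bk) r.
  have := dE k r; rewrite rk mulr0 -{1}(pospart_sub bk) bformDl bformNl; lia.
rewrite /exchange_rhs mulrDl mulrDr scalerDr -!scalerAl -!scalerAr.
by rewrite !(frame_comm skew fY _ r0) // vmE !scalerA ![qh K ^ (2 * _) * _]mulrC.
Qed.

Lemma mut_form_evec r : r (lshift p k) 0 = 0 ->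
  bform L' ek r = bform L (pospart bk) r - bform L ek r.
Proof.
move=> rk; rewrite (mut_qformE cS) bformMM (mutmx_fix _ rk) mutmx_evec.
by rewrite !bformE addrC.
Qed.

Lemma mut_form_fix a r : a (lshift p k) 0 = 0 -> r (lshift p k) 0 = 0 ->
  bform L' a r = bform L a r.
Proof. by move=> ak rk; rewrite (mut_qformE cS) bformMM !mutmx_fix. Qed.

Lemma new_var_comm r : nonneg_top r -> r (lshift p k) 0 = 0 ->
  z * Y r = qh K ^ (2 * bform L' ek r) *: (Y r * z).
Proof.
move=> r0 rk; apply: (torus_lcancel (frame_neq0 fY ek_ge0)).
rewrite mulrA Yz exchange_rhs_comm // -Yz mulrA (frame_comm skew fY r0) //.
rewrite -scalerAl scalerA expqhD -scalerAr mulrA; congr (qh K ^ _ *: _).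
by rewrite mut_form_evec // (bform_skew r) //; ring.
Qed.

Lemma new_varX_comm j r : nonneg_top r -> r (lshift p k) 0 = 0 ->
  z ^+ j * Y r = qh K ^ (2 * j%:Z * bform L' ek r) *: (Y r * z ^+ j).
Proof.
move=> r0 rk; elim: j => [|j IH].
  by rewrite mulr0 mul0r expr0z scale1r !expr0 mul1r mulr1.
rewrite exprSr -mulrA new_var_comm // -scalerAr (mulrA (z ^+ j)) IH.
rewrite -scalerAl scalerA expqhD.
by rewrite (mulrA (Y r)); congr (qh K ^ _ *: _); rewrite intS; ring.
Qed.

(* The two terms of the exchange relation q-commute with x_k with different   *)
(* exponents, so that they cannot cancel.                                     *)
Lemma new_var_neq0 : z != 0.
Proof.
apply/eqP => z0; have [d_gt0 _ dE] := cS.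
have rhs0 : exchange_rhs S Y k = 0 by rewrite -Yz z0 mulr0.
(* Multiplying the vanishing sum by [Y ek] on either side gives two relations between the same two
   terms; together they force [qh K ^ (2 * t) = qh K ^ (2 * s)]. *)
have := congr1 (fun u => Y ek * u) rhs0.
have := congr1 (fun u => u * Y ek) rhs0.
rewrite /exchange_rhs mul0r mulr0 mulrDl mulrDr -!scalerAl -!scalerAr.
rewrite !(frame_comm skew fY ek_ge0) //.
set P := Y _ * _; set Q := Y _ * _.
set s := bform L ek _; set t := bform L ek _.
move=> /eqP; rewrite addr_eq0 => /eqP PQ.
rewrite !scalerA mulrC [_ * qh K ^ (2 * t)]mulrC -!scalerA PQ scalerN addrC.
rewrite -scaleNr -scalerDl scalerA => /eqP.
rewrite scaler_eq0 mulf_eq0 (negPf (qhz_neq0 _ _)) orbF.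
have QY0 := torus_mul_neq0 (frame_neq0 fY vm_ge0) (frame_neq0 fY ek_ge0).
rewrite (negPf QY0) orbF.
rewrite subr_eq0 => /eqP ts.
have /qh_free : qh K ^ (2 * t - 2 * s) = 1.
  by rewrite -expqhD ts expqhD addrN.
(* The exponents differ by Lambda(e_k, b_k) = - d_k, which is nonzero. *)
have : s - t = - d 0 k.
  rewrite /s /t -bformNr -bformDr pospart_sub bform_skew // dE /evec !mxE !eqxx.
  by rewrite mulr1.
have := d_gt0 k; lia.
Qed.

(** The monomial of the mutated seed: its part without e_k is shared with the old seed, the rest is
    a power of the new variable z, and the power of q normalizes the product for the mutated form.
    For [nonneg_top a], [absz c] is c itself. *)
Definition frame_step a : qtorus K Lam0 :=
  let c := a (lshift p k) 0 in
  qh K ^ (- bform L' (a - c *: ek) (c *: ek))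
  *: (Y (a - c *: ek) * z ^+ absz c).

Lemma frame_step_fix a : a (lshift p k) 0 = 0 -> frame_step a = Y a.
Proof.
move=> ak; rewrite /frame_step ak scale0r subr0 bform0r oppr0 expr0z scale1r.
by rewrite expr0 mulr1.
Qed.

Lemma frame_step_evec : frame_step ek = z.
Proof.
have ekk : ek (lshift p k) 0 = 1 by rewrite /evec mxE !eqxx.
rewrite /frame_step ekk scale1r subrr bform0l oppr0 expr0z scale1r.
by rewrite (frame0 fY) mul1r expr1.
Qed.

Lemma coord_rest a : (a - a (lshift p k) 0 *: ek) (lshift p k) 0 = 0.
Proof. by rewrite /evec !mxE !eqxx mulr1 subrr. Qed.

Lemma nonneg_top_rest a :
  nonneg_top a -> nonneg_top (a - a (lshift p k) 0 *: ek).
Proof.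
move=> a0 i; have [->|ik] := eqVneq i k; first by rewrite coord_rest.
rewrite mxE [X in _ + X]mxE [X in _ - X]mxE evec_diff ?mulr0 ?subr0 //.
by rewrite eq_lshift eq_sym.
Qed.

(** Multiplicativity comes down to moving powers of z past monomials without e_k, on which the old
    and the mutated forms agree. *)
Lemma frame_step_frame : frame (qform (mut_seed S k)) frame_step.
Proof.
split=> [a b a0 b0|a a0|c c0]; last first.
- have ck : c (lshift p k) 0 = 0 by move/colP/(_ k): c0; rewrite !mxE.
  by rewrite frame_step_fix // (frame_frozen fY).
- rewrite /frame_step scaler_eq0 (negPf (qhz_neq0 _ _)) /=.
  rewrite torus_mul_neq0 ?(frame_neq0 fY) //; first exact: nonneg_top_rest.
  elim: (absz _) => [|j IH]; first by rewrite expr0 oner_neq0.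
  by rewrite exprS torus_mul_neq0 // new_var_neq0.
have ra := coord_rest a; have rb := coord_rest b.
have na := nonneg_top_rest a0; have nb := nonneg_top_rest b0.
rewrite /frame_step /= [(a + b) _ _]mxE.
set ca := a _ 0 in ra na *; set cb := b _ 0 in rb nb *.
have -> : a + b - (ca + cb) *: ek = (a - ca *: ek) + (b - cb *: ek).
  by rewrite scalerDl opprD addrACA.
have bE : bform L' a b =
    bform L' ((a - ca *: ek) + ca *: ek) ((b - cb *: ek) + cb *: ek).
  by rewrite !subrK.
rewrite bE.
move: (a - ca *: ek) (b - cb *: ek) ra rb na nb => ar br ra rb na nb.
have ca0 : 0 <= ca := a0 k; have cb0 : 0 <= cb := b0 k.
rewrite -!scalerAl -!scalerAr !scalerA -(mulrA (Y ar)) (mulrA (z ^+ _)).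
rewrite new_varX_comm //.
rewrite -scalerAl -scalerAr !scalerA -(mulrA (Y br)) (mulrA (Y ar)).
rewrite (frameM fY) // -!scalerAl !scalerA -exprD !expqhD.
congr (qh K ^ _ *: (_ * _ ^+ _)); last by lia.
rewrite -mut_form_fix // !bformE bform_diag // (bform_skew br ek) //.
by rewrite gez0_abs //; ring.
Qed.
End FrameStep.

(** * Transfer of clusters along a monomial morphism *)

Section Transfer.
Context (K : qfield) (n p p' : nat).
Context (Lam0 : 'M[int]_(n + p)) (Lam0' : 'M[int]_(n + p')).
Context (phi : {lrmorphism qtorus K Lam0 -> qtorus K Lam0'}).
Context (d d' : 'rV[int]_n) (S : qseed n p) (S' : qseed n p').
Context (Y : 'cV[int]_(n + p) -> qtorus K Lam0).
Context (Y' : 'cV[int]_(n + p') -> qtorus K Lam0').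
Context (M : 'M[int]_(n + p', n + p)) (k : 'I_n) (z : qtorus K Lam0).
Hypothesis qh_free : forall j : int, qh K ^ j = 1 -> j = 0.
Hypotheses (cS : compatible d S) (cS' : compatible d' S').
Hypothesis fY' : frame (qform S') Y'.
Hypothesis M_top : forall (a : 'cV[int]_(n + p)) (i : 'I_n),
  (M *m a) (lshift p' i) 0 = a (lshift p i) 0.
Hypothesis M_ext : M *m extmx S = extmx S'.
Hypothesis M_form : M^T *m qform S' *m M = qform S.
Hypothesis phiY : forall a, nonneg_top a -> phi (Y a) = Y' (M *m a).
Local Notation ek := (evec (lshift p k)).
Local Notation ek' := (evec (lshift p' k)).
Hypothesis Yz : Y ek * z = exchange_rhs S Y k.
Local Notation E := (mutmx S k).
Local Notation E' := (mutmx S' k).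
Local Notation L' := (qform S').

Definition mutM : 'M[int]_(n + p', n + p) := E' *m M *m E.

Let hp : 'cV[int]_(n + p') := M *m (E *m ek) - E' *m ek'.

(* The exponent hp is frozen, and the mutated matrix E' M E maps e_k to       *)
(* e_k + hp; the power of q normalizes phi(z) X'^(- hp).                      *)
Definition transfer_var : qtorus K Lam0' :=
  qh K ^ bform L' (E' *m ek') hp *: (phi z * tX (- hp)).
Local Notation z' := transfer_var.

Let skew' : L'^T = - L'. Proof. by case: cS'. Qed.

Lemma frozen_of_top (a : 'cV[int]_(n + p')) :
  (forall i, a (lshift p' i) 0 = 0) -> usubmx a = 0.
Proof. by move=> a0; apply/colP => i; rewrite !mxE. Qed.

Lemma transfer_nonneg (a : 'cV[int]_(n + p)) :
  nonneg_top a -> nonneg_top (M *m a).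
Proof. by move=> a0 i; rewrite M_top. Qed.

Lemma M_col i : M *m col i (extmx S) = col i (extmx S').
Proof. by rewrite -M_ext !colE mulmxA. Qed.

Lemma top_extmx i j : extmx S' (lshift p' i) j = extmx S (lshift p i) j.
Proof.
transitivity (col j (extmx S') (lshift p' i) 0); first by rewrite mxE.
by rewrite -M_col M_top mxE.
Qed.

(** E and E' act alike on the first n coordinates because the exchange matrices agree. *)
Lemma mutmx_top (a : 'cV[int]_(n + p)) (b : 'cV[int]_(n + p')) :
  (forall i, b (lshift p' i) 0 = a (lshift p i) 0) ->
  forall i, (E' *m b) (lshift p' i) 0 = (E *m a) (lshift p i) 0.
Proof.
move=> ab i; rewrite !mutmxE [LHS]mxE [RHS]mxE !ab; congr (_ + _).
by rewrite /evec !mxE top_extmx !eq_lshift.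
Qed.

Lemma mutM_top (a : 'cV[int]_(n + p)) i :
  (mutM *m a) (lshift p' i) 0 = a (lshift p i) 0.
Proof.
rewrite -!mulmxA (mutmx_top (a := E *m a)) ?(mutmxKv cS) //.
Qed.

(** The inner E cancels by involutivity, and the remaining column operations are the same on both
    sides. *)
Lemma mutM_ext : mutM *m mut_extmx S k = mut_extmx S' k.
Proof.
apply/matrixP => j i; transitivity ((mutM *m col i (mut_extmx S k)) j 0).
  by rewrite colE mulmxA -colE [RHS]mxE.
transitivity (col i (mut_extmx S' k) j 0); last by rewrite mxE.
congr (_ j 0); rewrite (mut_extmx_col cS) (mut_extmx_col cS') -!mulmxA.
have bk : E *m col k (extmx S) = col k (extmx S).
  by rewrite mutmx_fix // mxE (compatible_diag cS).
have bk' : E' *m col k (extmx S') = col k (extmx S').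
  by rewrite mutmx_fix // mxE (compatible_diag cS').
case: ifP => _; first by rewrite !mulmxN bk M_col bk'.
rewrite mulmxDr (mutmxKv cS) -!scalemxAr bk mulmxDr M_col -scalemxAr M_col.
by rewrite mulmxDr -scalemxAr bk' top_extmx.
Qed.

Lemma mutM_form : mutM^T *m mut_qform S' k *m mutM = mut_qform S k.
Proof.
apply: form_ext => i j.
rewrite (mut_qformE cS) (mut_qformE cS') !bformMM -M_form bformMM.
by rewrite -!(mulmxA _ _ (evec _)) -!(mulmxA _ M) !(mutmxKv cS').
Qed.

Let h : 'cV[int]_(n + p') := M *m ek - ek'.

Lemma evec_top i : ek' (lshift p' i) 0 = ek (lshift p i) 0.
Proof. by rewrite /evec !mxE !eq_lshift. Qed.

Let h_frozen : usubmx h = 0.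
Proof.
apply: frozen_of_top => i.
by rewrite [LHS]mxE [X in _ + X]mxE M_top evec_top subrr.
Qed.

Let hp_frozen : usubmx hp = 0.
Proof.
apply: frozen_of_top => i; rewrite [LHS]mxE [X in _ + X]mxE M_top.
by rewrite (mutmx_top (a := ek)) ?subrr // => j; rewrite evec_top.
Qed.

Let opp_frozen (a : 'cV[int]_(n + p')) : usubmx a = 0 -> usubmx (- a) = 0.
Proof. by move=> a0; rewrite raddfN /= a0 oppr0. Qed.

Let frozen_coord (a : 'cV[int]_(n + p')) :
  usubmx a = 0 -> a (lshift p' k) 0 = 0.
Proof. by move/colP/(_ k); rewrite !mxE. Qed.

Let form_hp_bk : bform L' (col k (extmx S')) hp = 0.
Proof. by have [_ _ ->] := cS'; rewrite frozen_coord ?mulr0. Qed.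

(** Both exchange monomials acquire the same frozen exponent h + hp; for the negative part, subtract
    M b_k = b'_k. *)
Lemma M_pospart : M *m pospart (col k (extmx S)) =
  pospart (col k (extmx S')) + h + hp.
Proof.
rewrite /h /hp !mutmx_evec mulmxDr mulmxN.
by apply/colP => i; rewrite !mxE; ring.
Qed.

(** Up to powers of q, the old variable of S' is X'^(- h) phi(x_k) and z' is phi(z) X'^(- hp). Their
    product is thus the image of the exchange relation between two frozen factors, which remove h +
    hp from each exponent. *)
Lemma transfer_exchange : Y' ek' * z' = exchange_rhs S' Y' k.
Proof.
have Yek : Y' ek' = qh K ^ bform L' h (M *m ek) *: (Y' (- h) * phi (Y ek)).
  rewrite phiY; last exact: nonneg_top_evec.
  rewrite (frameM fY'); [|exact/nonneg_top_frozen/opp_frozen|]; last first.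
    exact/transfer_nonneg/nonneg_top_evec.
  by rewrite scalerA expqhD bformNl addrN expr0z scale1r /h opprB subrK.
rewrite Yek /transfer_var -(frame_frozen fY'); last exact: opp_frozen.
rewrite -scalerAl -scalerAr scalerA expqhD mulrA -(mulrA (Y' (- h))) -rmorphM.
rewrite Yz.
(* One computation serves both exchange terms. Its last hypothesis holds for the second because
   Lambda'(b'_k, hp) = 0, hp being frozen. *)
have term (v : 'cV[int]_(n + p)) (v' : 'cV[int]_(n + p')) :
    nonneg_top v -> M *m v = v' + h + hp ->
    bform L' v' hp = bform L' (pospart (col k (extmx S'))) hp ->
  qh K ^ (bform L' h (M *m ek) + bform L' (E' *m ek') hp) *:
  (Y' (- h) * phi (qh K ^ bform (qform S) ek v *: Y v) * Y' (- hp)) =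
  qh K ^ bform L' ek' v' *: Y' v'.
  move=> v0 Mv v'hp.
  rewrite linearZ /= phiY // -scalerAr -scalerAl scalerA expqhD.
  have nh := nonneg_top_frozen (opp_frozen h_frozen).
  have nhp := nonneg_top_frozen (opp_frozen hp_frozen).
  have nMv := transfer_nonneg v0.
  rewrite (frameM fY') // -scalerAl (frameM fY') //; last exact: nonneg_topD.
  have -> : - h + M *m v - hp = v'.
    by rewrite Mv; apply/colP => i; rewrite !mxE; ring.
  rewrite !scalerA !expqhD; congr (qh K ^ _ *: _).
  rewrite -M_form bformMM mutmx_evec Mv.
  have -> : M *m ek = h + ek' by rewrite /h subrK.
  move: v'hp; move: (h) (hp) (pospart _) => h1 hp1 w v'hp.
  rewrite !bformE !bform_diag // v'hp (bform_skew ek' h1) //.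
  by ring.
rewrite /exchange_rhs /= (raddfD phi) mulrDr mulrDl scalerDr; congr (_ + _).
  apply: term => //; first exact: nonneg_top_pospart.
  exact: M_pospart.
have vmE m (b : 'cV[int]_m) : pospart (- b) = pospart b - b.
  by rewrite -{3}(pospart_sub b) opprB addrCA subrr addr0.
apply: term; first exact: nonneg_top_pospart.
  by rewrite !vmE mulmxBr M_col M_pospart addrAC; congr (_ + _); rewrite addrAC.
by rewrite vmE bformDl bformNl form_hp_bk subr0.
Qed.

Lemma mutM_fix (a : 'cV[int]_(n + p)) :
  a (lshift p k) 0 = 0 -> mutM *m a = M *m a.
Proof. by move=> ak; rewrite -!mulmxA (mutmx_fix _ ak) mutmx_fix // M_top. Qed.

(** Monomials without e_k are covered by [phiY], so only phi(z) has to be identified; the powers of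
    q then match by [mutM_form]. *)
Lemma transfer_frame a : nonneg_top a ->
  phi (frame_step S Y k z a) = frame_step S' Y' k z' (mutM *m a).
Proof.
move=> a0; have fY'1 := frame_step_frame qh_free cS' fY' transfer_exchange.
have skew1 : (qform (mut_seed S' k))^T = - qform (mut_seed S' k).
  by case: (mut_compatible cS' k).
have nMek : nonneg_top (mutM *m ek).
  by move=> i; rewrite mutM_top; apply: nonneg_top_evec.
have phiz : phi z = frame_step S' Y' k z' (mutM *m ek).
  have -> : mutM *m ek = ek' + hp.
    rewrite -!mulmxA -{1}[M *m _](subrK (E' *m ek')) -/hp mulmxDr (mutmxKv cS').
    by rewrite mutmx_fix ?frozen_coord // addrC.
  have := frameM fY'1 (@nonneg_top_evec n p' (lshift p' k))
    (nonneg_top_frozen hp_frozen).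
  rewrite (frame_step_evec _ _ fY') (frame_step_fix _ _ _ (frozen_coord hp_frozen)).
  rewrite /= (mut_qformE cS') bformMM (mutmx_fix _ (frozen_coord hp_frozen)).
  rewrite /transfer_var -scalerAl -mulrA -(frame_frozen fY'); last exact: opp_frozen.
  rewrite (frameM fY'); last 2 first.
  - exact/nonneg_top_frozen/opp_frozen.
  - exact: nonneg_top_frozen.
  rewrite bformNl bform_diag // oppr0 expr0z scale1r addNr (frame0 fY') mulr1.
  by apply: scalerI; apply: qhz_neq0.
rewrite {1}/frame_step linearZ rmorphM rmorphXn /= phiz.
set c := a _ 0; have c0 : 0 <= c := a0 k.
have rk := coord_rest k a; rewrite -/c in rk.
have nr := nonneg_top_rest k a0; rewrite -/c in nr.
rewrite phiY // -(@frame_step_fix _ _ _ _ S' Y' k z' (M *m (a - c *: ek)));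
  last by rewrite M_top.
rewrite (frameX skew1 fY'1) // gez0_abs // -mutM_fix //.
rewrite (frameM fY'1); last 2 first.
- by move=> i; rewrite mutM_top.
- exact: nonneg_topZ.
rewrite scalemxAr -mulmxDr subrK /= -bformMM mutM_form scalerA expqhD.
by rewrite addNr expr0z scale1r.
Qed.
End Transfer.

(** * Transfer along iterated mutations *)

Section TransferClass.
Context (K : qfield) (n p p' : nat) (S : qseed n p) (S' : qseed n p').
Context (d d' : 'rV[int]_n) (M : 'M[int]_(n + p', n + p)).
Context (phi : {lrmorphism qtorus K (qform S) -> qtorus K (qform S')}).
Hypothesis qh_free : forall j : int, qh K ^ j = 1 -> j = 0.
Hypotheses (cS : compatible d S) (cS' : compatible d' S').
Hypothesis M_top : forall (a : 'cV[int]_(n + p)) (i : 'I_n),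
  (M *m a) (lshift p' i) 0 = a (lshift p i) 0.
Hypothesis M_ext : M *m extmx S = extmx S'.
Hypothesis M_form : M^T *m qform S' *m M = qform S.
Hypothesis phiX : forall a, phi (tX a) = tX (M *m a).

(** The induction mutates both seeds in the same direction and carries the matrix along; the new
    variable for S' is produced as the [transfer_var] of the one for S. *)
Lemma mut_class_transfer x St : @mut_class K n p S x St ->
  exists x' St' Y Y' (Mt : 'M[int]_(n + p', n + p)),
  [/\ @mut_class K n p' S' x' St', forall i, x i = Y (evec i) &
      forall i, x' i = Y' (evec i)] /\
  [/\ compatible d St, compatible d' St', frame (qform St) Y &
      frame (qform St') Y'] /\
  [/\ forall (a : 'cV[int]_(n + p)) (i : 'I_n),
        (Mt *m a) (lshift p' i) 0 = a (lshift p i) 0,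
      Mt *m extmx St = extmx St',
      Mt^T *m qform St' *m Mt = qform St &
      forall a, nonneg_top a -> phi (Y a) = Y' (Mt *m a)].
Proof.
elim=> [|{}x {}St k xn _ IH xn_fix xn_k].
  exists (fun i => tX (evec i)), S', (fun a => tX a), (fun a => tX a), M.
  split; first by split=> //; apply: mut_class_init.
  split; first by split=> //; apply: initial_frame.
  by split.
have [x' [St' [Y [Y' [Mt [[cl xE x'E] [[cSt cSt' fY fY']
  [top ext form phiY]]]]]]]] := IH.
have Yz : Y (evec (lshift p k)) * xn (lshift p k) = exchange_rhs St Y k.
  by rewrite -xE xn_k (cleval_exchange _ cSt fY xE).
pose z' := transfer_var phi St St' Mt k (xn (lshift p k)).
have Yz' := transfer_exchange cSt' fY' top ext form phiY Yz.
exists (fun i => frame_step St' Y' k z' (evec i)), (mut_seed St' k),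
  (frame_step St Y k (xn (lshift p k))), (frame_step St' Y' k z'),
  (mutM St St' Mt k).
split; first split=> //.
- apply: (mut_class_step cl) => [j jk|].
    by rewrite frame_step_fix ?evec_diff // x'E.
  by rewrite (frame_step_evec _ _ fY') x'E Yz' (cleval_exchange _ cSt' fY' x'E).
- move=> i; have [->|ik] := eqVneq i (lshift p k).
    by rewrite (frame_step_evec _ _ fY).
  by rewrite frame_step_fix ?evec_diff // xn_fix // xE.
split; first split.
- exact: mut_compatible.
- exact: mut_compatible.
- exact: (frame_step_frame qh_free cSt fY Yz).
- exact: (frame_step_frame qh_free cSt' fY' Yz').
split.
- exact: (mutM_top _ cSt top ext).
- exact: (mutM_ext _ cSt cSt' top ext).
- exact: (mutM_form _ cSt cSt' form).
- exact: (transfer_frame qh_free cSt cSt' fY' top ext form phiY Yz).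
Qed.

Lemma in_qcluster_transfer u : in_qcluster u -> in_qcluster (phi u).
Proof.
elim=> [a|x St i cl|v w _ IHv _ IHw|v w _ IHv _ IHw|c v _ IHv].
- rewrite phiX -[M *m _]vsubmxK.
  suff -> : usubmx (M *m col_mx 0 a) = 0 by apply: in_qcluster_frozen.
  by apply/colP => j; rewrite [LHS]mxE M_top col_mxEu.
- have [x' [St' [Y [Y' [Mt [[cl' xE x'E] [[_ _ _ fY'] [top _ _ phiY]]]]]]]] :=
    mut_class_transfer cl.
  rewrite xE phiY; last exact: nonneg_top_evec.
  (* As h is frozen, the image is a cluster variable times a frozen monomial, up to a power of q. *)
  set h := Mt *m evec (lshift p i) - evec (lshift p' i).
  have h0 : usubmx h = 0.
    apply/colP => j; rewrite [LHS]mxE [LHS]mxE [X in _ + X]mxE top.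
    by rewrite /evec !mxE !eq_lshift subrr.
  pose e := bform (qform St') (evec (lshift p' i)) h.
  have /(congr1 (fun u => qh K ^ (- e) *: u)) :=
    frameM fY' (@nonneg_top_evec n p' (lshift p' i)) (nonneg_top_frozen h0).
  rewrite scalerA expqhD addNr expr0z scale1r addrC subrK => <-.
  apply: in_qclusterZ; apply: in_qclusterM.
    by rewrite -x'E; exact: (in_qcluster_var i cl').
  by rewrite (frame_frozen fY') // -(vsubmxK h) h0; apply: in_qcluster_frozen.
- by rewrite raddfD; apply: in_qclusterD.
- by rewrite rmorphM; apply: in_qclusterM.
- by rewrite linearZ; apply: in_qclusterZ.
Qed.
End TransferClass.

(** * Morphisms of quantum tori and their restrictions *)

Lemma torus_ind (K : qfield) m (Lam : 'M[int]_m) (P : qtorus K Lam -> Prop) :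
  P 0 -> (forall u v, P u -> P v -> P (u + v)) ->
  (forall c a, P (c *: tX a)) -> forall u, P u.
Proof. by move=> P0 PD PX u; rewrite [u]tXE; apply: big_ind. Qed.

Lemma monomial_morphism (K : qfield) m m' (Lam : 'M[int]_m) (Lam' : 'M[int]_m')
    (M : 'M[int]_(m', m)) : M^T *m Lam' *m M = Lam ->
  exists phi : {lrmorphism qtorus K Lam -> qtorus K Lam'},
    forall a, phi (tX a) = tX (M *m a).
Proof.
move=> MLM.
pose f (u : qtorus K Lam) : qtorus K Lam' := linext (fun a => tX (M *m a)) u.
have fX a : f (tX a) = tX (M *m a) by rewrite /f linextX.
have fD u v : f (u + v) = f u + f v by apply: linextD.
have fZ c u : f (c *: u) = c *: f u by apply: linextZ.
have f0 : f 0 = 0 by rewrite -(scale0r 0) fZ scale0r.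
have fM u v : f (u * v) = f u * f v.
  elim/torus_ind: u => [|u1 u2 IH1 IH2|c a]; first by rewrite mul0r f0 mul0r.
    by rewrite mulrDl !fD mulrDl IH1 IH2.
  elim/torus_ind: v => [|v1 v2 IH1 IH2|e b]; first by rewrite mulr0 f0 mulr0.
    by rewrite mulrDr !fD mulrDr IH1 IH2.
  rewrite -scalerAl -scalerAr !fZ -scalerAl -scalerAr; congr (_ *: (_ *: _)).
  by rewrite tXM fZ !fX tXM mulmxDr -MLM bformMM.
have f_lin : linear f by move=> c u v; rewrite fD fZ.
have f_mon : GRing.monoid_morphism f by split=> //; rewrite -/(tX 0) fX mulmx0.
pose phi : {lrmorphism qtorus K Lam -> qtorus K Lam'} :=
  HB.pack f (GRing.isLinear.Build K _ _ *:%R f f_lin)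
    (GRing.isMonoidMorphism.Build _ _ f f_mon).
by exists phi.
Qed.

Lemma qcluster_restrict (K : qfield) n p p' (S : qseed n p) (S' : qseed n p')
    (phi : {lrmorphism qtorus K (qform S) -> qtorus K (qform S')}) :
  (forall u, in_qcluster u -> in_qcluster (phi u)) ->
  exists F : {lrmorphism qcluster K S -> qcluster K S'},
    forall u, qcval (F u) = phi (qcval u).
Proof.
move=> phi_in.
have phiP (u : qcluster K S) : phi (qcval u) \in @qcluster_pred K n p' S'.
  by apply/qclusterP/phi_in/qclusterP/qcvalP.
pose f u := QCluster (phiP u).
have f_lin : linear f.
  by move=> c u v; apply: val_inj; rewrite /= !linearP.
have f_mon : GRing.monoid_morphism f.
  split=> [|u v]; apply: val_inj; rewrite /= ?rmorph1 ?rmorphM //.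
pose F : {lrmorphism qcluster K S -> qcluster K S'} :=
  HB.pack f (GRing.isLinear.Build K _ _ *:%R f f_lin)
    (GRing.isMonoidMorphism.Build _ _ f f_mon).
by exists F.
Qed.

Lemma torus_comm (K : qfield) m (Lam : 'M[int]_m) (a b : 'cV[int]_m) :
  Lam^T = - Lam ->
  tX a * tX b = qh K ^ (2 * bform Lam a b) *: (tX b * tX a) :> qtorus K Lam.
Proof.
move=> skew; rewrite !tXM scalerA expqhD (addrC b); congr (_ ^ _ *: _).
by rewrite (bform_skew b a skew); ring.
Qed.

Section MonomialRigidity.
Context (K : qfield) (m m' : nat) (Lam : 'M[int]_m) (Lam' : 'M[int]_m').
Context (M : 'M[int]_(m', m)) (phi : {lrmorphism qtorus K Lam -> qtorus K Lam'}).
Hypothesis qh_free : forall j : int, qh K ^ j = 1 -> j = 0.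
Hypotheses (skew : Lam^T = - Lam) (skew' : Lam'^T = - Lam').
Hypothesis phi_evec : forall i, phi (tX (evec i)) = tX (M *m evec i).

(** Apply phi to the q-commutation of two variables: the two powers of q must agree, hence so do
    their exponents, q not being a root of unity. *)
Lemma form_of_morphism : M^T *m Lam' *m M = Lam.
Proof.
apply: form_ext => i j; rewrite bformMM.
have := congr1 phi (torus_comm K (evec i) (evec j) skew).
rewrite linearZ /= !rmorphM /= !phi_evec (torus_comm _ _ _ skew') => /eqP.
rewrite -subr_eq0 -scalerBl scaler_eq0.
rewrite (negPf (torus_mul_neq0 (tX_neq0 _ _ _) (tX_neq0 _ _ _))) orbF.
rewrite subr_eq0 => /eqP E.
have /qh_free : qh K ^ (2 * bform Lam' (M *m evec i) (M *m evec j)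
    - 2 * bform Lam (evec i) (evec j)) = 1 by rewrite -expqhD E expqhD addrN.
lia.
Qed.

Let mono (a : 'cV[int]_m) := phi (tX a) = tX (M *m a).

Let tX_add m0 (Lam0 : 'M[int]_m0) (a b : 'cV[int]_m0) :
  tX (a + b) = qh K ^ (- bform Lam0 a b) *: (tX a * tX b) :> qtorus K Lam0.
Proof. by rewrite tXM scalerA expqhD addNr expr0z scale1r. Qed.

Lemma morphism_monomial a : phi (tX a) = tX (M *m a).
Proof.
have mono0 : mono 0.
  have tX0 m0 (Lam0 : 'M[int]_m0) : tX 0 = 1 :> qtorus K Lam0 by [].
  by rewrite /mono mulmx0 !tX0 rmorph1.
have monoD b c : mono b -> mono c -> mono (b + c).
  rewrite /mono => mb mc; rewrite tX_add linearZ rmorphM /= mb mc mulmxDr tX_add.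
  by rewrite -[in LHS]form_of_morphism bformMM.
(* X^(- b) is the inverse of X^b, so its image is found by cancelling X'^(M b). *)
have monoN b : mono b -> mono (- b).
  move=> mb; apply: (torus_lcancel (tX_neq0 K Lam' (M *m b))).
  rewrite -{1}mb -rmorphM !tXM mulmxN !addrN !bformNr !bform_diag // oppr0 expr0z.
  by rewrite !scale1r; move: mono0; rewrite /mono mulmx0.
have monoZ (c : int) b : mono b -> mono (c *: b).
  move=> mb; elim/int_rect: c => [|j IH|j IH]; first by rewrite scale0r.
    by rewrite intS scalerDl scale1r; apply: monoD.
  by rewrite intS opprD scalerDl scaleN1r; apply: monoD => //; apply: monoN.
rewrite (vec_sum a); apply: (big_ind mono) => // i _.
by apply: monoZ; apply: phi_evec.
Qed.
End MonomialRigidity.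

(** * The matrix R and the equivalence *)

Section ExponentMatrix.
Context (n p p' : nat) (H : 'M[int]_(p', n)) (L : 'M[int]_(p', p)).
Let M : 'M[int]_(n + p', n + p) := block_mx 1%:M 0 H L.

Lemma block_evec_l i :
  M *m evec (lshift p i) = evec (lshift p' i) + col_mx 0 (col i H).
Proof.
rewrite /evec -colE /M block_mxEh colKl col_col_mx delta_mx_ushift add_col_mx.
by rewrite addr0 add0r colE mul1mx.
Qed.

Lemma block_evec_r j : M *m evec (rshift n j) = col_mx 0 (col j L).
Proof. by rewrite /evec -colE /M block_mxEh colKr col_col_mx col0. Qed.

Lemma block_top (a : 'cV[int]_(n + p)) i :
  (M *m a) (lshift p' i) 0 = a (lshift p i) 0.
Proof.
by rewrite -(vsubmxK a) /M mul_block_col mul1mx mul0mx addr0 !col_mxEu.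
Qed.
End ExponentMatrix.

Theorem proposition2p8 (R : realType) (n p p' : nat) (n_gt1 : (1 < n)%N)
    (S : qseed n p) (S' : qseed n p')
    (seedS : quantum_seed S) (seedS' : quantum_seed S')
    (eqB : exmx S = exmx S')
    (f : 'I_(n + p) -> qtorus (Cq R) (qform S')) :
  induces_quasi_hom S S' f <->
  exists (H : 'M[int]_(p', n)) (L : 'M[int]_(p', p)),
    let M : 'M[int]_(n + p', n + p) := block_mx 1%:M 0 H L in
    [/\ forall i : 'I_n,
          f (lshift p i) = tX (evec (lshift p' i) + col_mx 0 (col i H)),
        forall j : 'I_p, f (rshift n j) = tX (col_mx 0 (col j L)),
        M *m extmx S = extmx S' &
        M^T *m qform S' *m M = qform S].
Proof.
have [d cS] := seed_compatible seedS; have [d' cS'] := seed_compatible seedS'.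
have qh_free := @Cq_qh_free R.
have [_ skew _] := cS; have [_ skew' _] := cS'.
split=> [[F [Ff [_ [h hP] [l lP] [phi [phiF phiy]]]]]|[H [L [fl fr M_ext M_form]]]].
  pose H : 'M[int]_(p', n) := \matrix_(r, i) dsubmx (h i) r 0.
  pose L : 'M[int]_(p', p) := \matrix_(r, j) dsubmx (l j) r 0.
  have hE i : h i = col_mx 0 (col i H).
    rewrite -[LHS]vsubmxK (proj1 (hP i)); congr col_mx.
    by apply/colP => r; rewrite [RHS]mxE [RHS]mxE.
  have lE j : l j = col_mx 0 (col j L).
    rewrite -[LHS]vsubmxK (proj1 (lP j)); congr col_mx.
    by apply/colP => r; rewrite [RHS]mxE [RHS]mxE.
  have fl i : f (lshift p i) = tX (evec (lshift p' i) + col_mx 0 (col i H)).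
    by rewrite -Ff (proj2 (hP i)) hE.
  have fr j : f (rshift n j) = tX (col_mx 0 (col j L)).
    by rewrite -Ff (proj2 (lP j)) lE.
  exists H, L; set M := block_mx _ _ _ _ => /=.
  (* The extension of the quasi-homomorphism to the tori takes the prescribed values on the initial
     variables. *)
  have phi_evec i : phi (tX (evec i)) = tX (M *m evec i).
    rewrite -[tX (evec i)]/(qcval (initvar (Cq R) S i)) phiF Ff -(splitK i).
    by case: (split i) => j /=; rewrite ?block_evec_l ?block_evec_r.
  split=> //; last exact: (form_of_morphism qh_free skew skew' phi_evec).
  (* Condition 3: distinct exponents give distinct monomials, so the images of the X^{b_i} determine
     the columns of R B~. *)
  apply/matrixP => j i; have := phiy i.
  rewrite (morphism_monomial qh_free skew skew' phi_evec) => /tX_inj/colP/(_ j).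
  by rewrite colE mulmxA -colE !mxE.
set M := block_mx _ _ _ _ in M_ext M_form.
have [phi phiX] := monomial_morphism (Cq R) M_form.
have [F FE] := qcluster_restrict
  (in_qcluster_transfer qh_free cS cS' (block_top H L) M_ext M_form phiX).
have Ff i : qcval (F (initvar (Cq R) S i)) = f i.
  rewrite FE /= phiX -(splitK i).
  by case: (split i) => j /=; rewrite ?block_evec_l ?block_evec_r.
exists F; split=> //; split=> //.
- by exists (fun i => col_mx 0 (col i H)) => i; rewrite Ff col_mxKu.
- by exists (fun j => col_mx 0 (col j L)) => j; rewrite Ff col_mxKu.
- exists phi; split=> // i; rewrite phiX -M_ext; congr tX.
  by rewrite !colE mulmxA.
Qed.
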